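(* Let $k$ be an algebraically closed field, $A$ a finite-dimensional unital associative $k$-algebra, and let $\mathcal{T},\mathcal{F}$ be subcategories of $\mathrm{mod}\,A$. If $(\mathcal{T},\mathcal{F})$ is a pretorsion theory in $\mathrm{mod}\,A$, then $\mathcal{T}=\mathrm{Gen}(\mathcal{X})$ and $\mathcal{F}=\mathrm{Cogen}(\mathcal{Y})$ for two classes $\mathcal{X},\mathcal{Y}$ of indecomposable modules. Moreover: (1) if $\mathcal{T}$ is a torsion class and $\mathcal{F}$ is a torsion-free class, then $(\mathcal{T},\mathcal{F})$ is a pretorsion theory if and only if ${}^\perp\mathcal{F}\subseteq\mathcal{T}$, if and only if $\mathcal{T}^\perp\subseteq\mathcal{F}$; (2) if $(\mathcal{T},\mathcal{F})$ is a pretorsion theory, then $\mathcal{T}^\perp\subseteq\mathcal{F}$ and ${}^\perp\mathcal{F}\subseteq\mathcal{T}$; (3) if $\mathcal{T}\in\mathcal{L}_t(A)$, $\mathcal{F}\in\mathcal{L}_{tf}(A)$ and $\mathrm{add}(\mathcal{T}\cup\mathcal{F})=\mathrm{mod}\,A$, then $(\mathcal{T},\mathcal{F})$ is a pretorsion theory.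
   Context: $\mathrm{mod}\,A$ is the category of finitely generated right $A$-modules. All subcategories are full and closed under isomorphisms. Pretorsion theories: let $\mathcal{Z}$ be a class of objects in a category $\mathcal{C}$. A morphism is $\mathcal{Z}$-trivial if it factors through an object of $\mathcal{Z}$; $\mathsf{Triv}(X,Y)$ is the class of $\mathcal{Z}$-trivial morphisms $X\to Y$. A morphism $\varepsilon:X\to B$ is a $\mathcal{Z}$-kernel of $f:B\to B'$ if $f\varepsilon$ is $\mathcal{Z}$-trivial and every $\lambda:Y\to B$ with $f\lambda$ $\mathcal{Z}$-trivial factors uniquely as $\lambda=\varepsilon\lambda'$; $\mathcal{Z}$-cokernels are defined dually. A sequence $B\xrightarrow{f}C\xrightarrow{g}D$ is short $\mathcal{Z}$-exact if $f$ is a $\mathcal{Z}$-kernel of $g$ and $g$ is a $\mathcal{Z}$-cokernel of $f$. A pair $(\mathcal{T},\mathcal{F})$ of subcategories of $\mathcal{C}$ is a pretorsion theory if, with $\mathcal{Z}:=\mathcal{T}\cap\mathcal{F}$, one has $\mathrm{Hom}(T,F)=\mathsf{Triv}(T,F)$ for all $T\in\mathcal{T}$, $F\in\mathcal{F}$, and for every object $X$ there is a short $\mathcal{Z}$-exact sequence $T_X\to X\to F_X$ with $T_X\in\mathcal{T}$, $F_X\in\mathcal{F}$. In $\mathrm{mod}\,A$: $\mathcal{L}_t(A)$ is the lattice (under inclusion) of pretorsion classes, i.e. the first halves of pretorsion theories, which are exactly the subcategories containing $0$ and closed under quotients and finite direct sums; $\mathcal{L}_{tf}(A)$ is the lattice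 of pretorsion-free classes, i.e. the second halves of pretorsion theories, which are exactly the subcategories containing $0$ and closed under submodules and finite direct sums. A torsion class (resp. torsion-free class) is a pretorsion class (resp. pretorsion-free class) also closed under extensions. $\mathrm{Gen}(\mathcal{S})$ (resp. $\mathrm{Cogen}(\mathcal{S})$) is the smallest pretorsion (resp. pretorsion-free) class containing the class of modules $\mathcal{S}$. $\mathrm{add}(\mathcal{S})$ is the subcategory of modules isomorphic to finite direct sums of modules in $\mathcal{S}$. $\mathcal{T}^\perp$ is the class of $X\in\mathrm{mod}\,A$ with $\mathrm{Hom}(T,X)=0$ for all $T\in\mathcal{T}$, and ${}^\perp\mathcal{F}$ is the class of $X\in\mathrm{mod}\,A$ with $\mathrm{Hom}(X,F)=0$ for all $F\in\mathcal{F}$. *)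

(* Defs.v *)
From HB Require Import structures.
From mathcomp Require Import all_boot all_order all_algebra.

Set Implicit Arguments.
Unset Strict Implicit.
Unset Printing Implicit Defensive.

Import GRing.Theory.
Local Open Scope ring_scope.

(* A finite-dimensional k-algebra is given as a ring together with a structure
   morphism from k into its centre.  Unlike falgType, this does not impose
   1 != 0, so the zero algebra is allowed. *)
Definition findim_algebra (k : fieldType) (A : pzRingType)
    (iota : {rmorphism k -> A}) : Prop :=
  (forall (c : k) (a : A), iota c * a = a * iota c) /\
  exists (n : nat) (e : 'I_n -> A),
    forall a : A, exists c : 'I_n -> k, a = \sum_(i < n) iota (c i) * e i.

(* Right A-modules are left modules over the converse ring: a *: x is x a. *)
Definition finitely_generated (A : pzRingType) (M : lmodType A^c) : Prop :=
  exists (n : nat) (g : 'I_n -> M),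
    forall x : M, exists a : 'I_n -> A^c, x = \sum_(i < n) a i *: g i.

Record fgmod (A : pzRingType) := FgMod {
  fgmod_lmod :> lmodType A^c;
  fgmod_fg : finitely_generated fgmod_lmod
}.

(* classical_sets.set (fgmod A) is a universe inconsistency, so classes of
   modules are bare predicates, compared pointwise. *)
Definition mod_class (A : pzRingType) := fgmod A -> Prop.

Section ModuleCategory.
Variable A : pzRingType.
Implicit Types (L M N X Y : fgmod A) (S T F Z : mod_class A).

Definition subclass S T : Prop := forall M, S M -> T M.

Definition eqclass S T : Prop := forall M, S M <-> T M.

Definition capclass S T : mod_class A := fun M => S M /\ T M.

Definition cupclass S T : mod_class A := fun M => S M \/ T M.

Definition allclass : mod_class A := fun=> True.

Definition isomorphic (M N : lmodType A^c) : Prop :=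
  exists f : {linear M -> N}, bijective f.

Definition zero_module (M : lmodType A^c) : Prop := forall x : M, x = 0.

Definition indecomposable : mod_class A :=
  fun M => ~ zero_module M /\
    forall N1 N2 : fgmod A, isomorphic M (N1 * N2)%type ->
      zero_module N1 \/ zero_module N2.

Definition iso_closed S : Prop :=
  forall M N, isomorphic M N -> S M -> S N.

Definition trivial_mor Z M N (f : M -> N) : Prop :=
  exists Z0 : fgmod A, Z Z0 /\
    exists (a : {linear M -> Z0}) (b : {linear Z0 -> N}), f =1 b \o a.

Definition Zkernel Z X M N (eps : {linear X -> M}) (f : {linear M -> N}) :
    Prop :=
  trivial_mor Z (f \o eps) /\
  forall Y (l : {linear Y -> M}), trivial_mor Z (f \o l) ->
    exists2 l' : {linear Y -> X}, l =1 eps \o l' &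
      forall l'' : {linear Y -> X}, l =1 eps \o l'' -> l'' =1 l'.

Definition Zcokernel Z M N X (eta : {linear N -> X}) (f : {linear M -> N}) :
    Prop :=
  trivial_mor Z (eta \o f) /\
  forall Y (l : {linear N -> Y}), trivial_mor Z (l \o f) ->
    exists2 l' : {linear X -> Y}, l =1 l' \o eta &
      forall l'' : {linear X -> Y}, l =1 l'' \o eta -> l'' =1 l'.

Definition short_Zexact Z L M N (f : {linear L -> M}) (g : {linear M -> N}) :
    Prop :=
  Zkernel Z f g /\ Zcokernel Z g f.

Definition pretorsion_theory T F : Prop :=
  [/\ iso_closed T, iso_closed F,
      forall M N, T M -> F N ->
        forall f : {linear M -> N}, trivial_mor (capclass T F) f &
      forall X, exists (TX FX : fgmod A)
          (f : {linear TX -> X}) (g : {linear X -> FX}),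
        [/\ T TX, F FX & short_Zexact (capclass T F) f g]].

Definition pretorsion_class T : Prop := exists F, pretorsion_theory T F.

Definition pretorsionfree_class F : Prop := exists T, pretorsion_theory T F.

Definition extension_closed S : Prop :=
  forall L M N (f : {linear L -> M}) (g : {linear M -> N}),
    injective f ->
    (forall x : M, g x = 0 <-> exists y : L, f y = x) ->
    (forall z : N, exists x : M, g x = z) ->
    S L -> S N -> S M.

Definition torsion_class T : Prop := pretorsion_class T /\ extension_closed T.

Definition torsionfree_class F : Prop :=
  pretorsionfree_class F /\ extension_closed F.

(* The smallest pretorsion (resp. pretorsion-free) class containing S, as the
   intersection of all of them; both kinds are stable under intersection. *)
Definition Gen S : mod_class A :=
  fun M => forall T, pretorsion_class T -> subclass S T -> T M.

Definition Cogen S : mod_class A :=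
  fun M => forall F, pretorsionfree_class F -> subclass S F -> F M.

Fixpoint dsum (n : nat) : ('I_n -> fgmod A) -> lmodType A^c :=
  match n return ('I_n -> fgmod A) -> lmodType A^c with
  | 0 => fun=> 'rV[A^c]_0
  | n'.+1 => fun V => (V ord0 * dsum (fun i : 'I_n' => V (lift ord0 i)))%type
  end.

Definition add_class S : mod_class A :=
  fun M => exists (n : nat) (V : 'I_n -> fgmod A),
    (forall i, S (V i)) /\ isomorphic M (dsum V).

Definition right_perp T : mod_class A :=
  fun X => forall M, T M -> forall f : {linear M -> X}, f =1 (fun=> 0).

Definition left_perp F : mod_class A :=
  fun X => forall N, F N -> forall f : {linear X -> N}, f =1 (fun=> 0).

End ModuleCategory.

Arguments indecomposable {A}.
Arguments allclass {A}.

(* Main.v *)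
From HB Require Import structures.
From mathcomp Require Import all_boot all_order all_algebra.
From mathcomp Require Import generic_quotient ring_quotient.
From mathcomp Require Import boolp.
Require Import Defs.

(* In a pretorsion theory the Z-kernels are injective and the Z-cokernels
   surjective, so T_X is the trace of T in X (the largest submodule of X in T)
   and X -> F_X is the quotient by the reject of F (the common kernel of all maps
   from X to F).  Conversely, given a pretorsion class T and a pretorsion-free
   class F, trace and reject yield a pretorsion theory as soon as
   (K) an element x of X whose image in F_X lies in the image of a map from T
       belongs to the trace, and
   (C) a map from the trace to F kills the reject.
   In (1) the reject R of X has no nonzero map to F (push out along R -> X, using
   that F is closed under extensions), so R is in T; this gives (C), and (K)
   follows by pulling X -> F_X back to an extension of a module in T by R.  In
   (3) write X as the sum of its parts in T and in F.
   The first assertion is the existence of decompositions into indecomposables,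
   by induction on the dimension. *)

Set Implicit Arguments.
Unset Strict Implicit.
Unset Printing Implicit Defensive.

Import GRing.Theory.
Local Open Scope quotient_scope.
Local Open Scope ring_scope.

(** * Submodules and quotient modules *)

Section Submodules.
Variables (R : pzRingType) (M : lmodType R).

Section Structures.
Variable S : submodClosed M.

Definition submod := {x : M | x \in S}.

HB.instance Definition _ := SubChoice.on submod.
HB.instance Definition _ := [SubChoice_isSubLmodule of submod by <:].

(* [submodClosed] does not inherit from [zmodClosed], which [quot] expects. *)
Fact submod_zmod_closed : GRing.zmod_closed (S : {pred M}).
Proof.
by split=> [|x y Sx Sy]; rewrite ?rpred0 // -scaleN1r rpredD // rpredZ.
Qed.

Definition submod_zmodClosed : zmodClosed M :=
  HB.pack (S : {pred M})
    (GRing.isZmodClosed.Build M (S : {pred M}) submod_zmod_closed).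

Definition quotmod := Quotient.quot submod_zmodClosed.

HB.instance Definition _ := GRing.Zmodule.on quotmod.
HB.instance Definition _ := EqQuotient.on quotmod.

Local Notation Q := quotmod.

Definition qscale (a : R) : Q -> Q := lift_op1 Q ( *:%R a).

Lemma pi_quotmod x y : (\pi_Q x == \pi_Q y) = (x - y \in S).
Proof. exact/esym/(Quotient.idealrBE submod_zmodClosed). Qed.

Lemma pi_qscale a : {morph \pi_Q : x / a *: x >-> qscale a x}.
Proof.
move=> x; unlock qscale; apply/eqP; rewrite pi_quotmod -scalerBr.
by rewrite rpredZ // -pi_quotmod reprK.
Qed.

Lemma qscaleA a b v : qscale a (qscale b v) = qscale (a * b) v.
Proof. by rewrite -[v]reprK -!pi_qscale scalerA. Qed.

Lemma qscale1 : left_id 1 qscale.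
Proof. by move=> v; rewrite -[v]reprK -pi_qscale scale1r. Qed.

Lemma qscaleDr : right_distributive qscale +%R.
Proof.
move=> a u v; rewrite -[u]reprK -[v]reprK -!pi_qscale -[in LHS]raddfD.
by rewrite -pi_qscale scalerDr raddfD.
Qed.

Lemma qscaleDl v : {morph qscale^~ v : a b / a + b}.
Proof.
by move=> a b; rewrite -[v]reprK -!pi_qscale scalerDl raddfD.
Qed.

HB.instance Definition _ :=
  GRing.Zmodule_isLmodule.Build R Q qscaleA qscale1 qscaleDr qscaleDl.
HB.instance Definition _ := GRing.isScalable.Build R M Q *:%R \pi_Q pi_qscale.

End Structures.

(** Classical truth values turn a Prop-valued predicate, such as lying in a kernel or an image, into
    a boolean one. *)
Lemma submod_closedP (P : M -> Prop) :
    P 0 -> (forall a x y, P x -> P y -> P (a *: x + y)) ->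
  exists S : submodClosed M, forall x, x \in S <-> P x.
Proof.
move=> P0 PS; pose p : {pred M} := fun x => `[< P x >].
have hp : GRing.subsemimod_closed p.
  apply: GRing.submod_closed_semi; split=> [|a x y]; first exact/asboolP.
  by rewrite !unfold_in => /asboolP Px /asboolP Py; apply/asboolP/PS.
pose S : submodClosed M := HB.pack p (GRing.isSubmodClosed.Build R M p hp).
by exists S => x; split=> /asboolP.
Qed.

Lemma submodule_exists (P : M -> Prop) :
    P 0 -> (forall a x y, P x -> P y -> P (a *: x + y)) ->
  exists (N : lmodType R) (i : {linear N -> M}),
    injective i /\ forall x, P x <-> exists y, i y = x.
Proof.
move=> P0 PS; have [S SP] := submod_closedP P0 PS.
exists (submod S), \val; split; first exact: val_inj.
move=> x; rewrite -SP; split=> [Sx|[y <-]]; last exact: valP.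
by exists (exist _ x Sx).
Qed.

Lemma quotient_exists (P : M -> Prop) :
    P 0 -> (forall a x y, P x -> P y -> P (a *: x + y)) ->
  exists (Q : lmodType R) (q : {linear M -> Q}),
    (forall z, exists x, q x = z) /\ forall x, q x = 0 <-> P x.
Proof.
move=> P0 PS; have [S SP] := submod_closedP P0 PS.
exists (quotmod S), (\pi_(quotmod S)); split=> [z|x].
  by exists (repr z); apply: reprK.
rewrite -SP -[X in X \in S](subr0 x) -pi_quotmod raddf0.
by split=> /eqP.
Qed.

End Submodules.

(** * Factoring linear maps through injections and surjections *)

Section Lifting.
Variables (R : pzRingType) (L M N : lmodType R).

Lemma lift_injective (i : {linear M -> N}) (l : {linear L -> N}) :
    injective i -> (forall y, exists x, i x = l y) ->
  exists l' : {linear L -> M}, l =1 i \o l'.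
Proof.
move=> inji il; have [f fE] := choice il.
have flin : linear f.
  by move=> a x y; apply: inji; rewrite !linearP !fE linearP.
pose F : {linear L -> M} := HB.pack f (GRing.isLinear.Build R L M *:%R f flin).
by exists F => y /=; rewrite fE.
Qed.

(** For any set-theoretic section [s] of [q], the map [l \o s] is linear because [l] kills the
    kernel of [q]. *)
Lemma lift_surjective (q : {linear L -> M}) (l : {linear L -> N}) :
    (forall z, exists x, q x = z) -> (forall x, q x = 0 -> l x = 0) ->
  exists l' : {linear M -> N}, l =1 l' \o q.
Proof.
move=> surq ker; have [s sK] := choice surq.
have fE x : l (s (q x)) = l x.
  by apply/eqP; rewrite -subr_eq0 -linearB ker // linearB sK subrr.
have flin : linear (l \o s).
  move=> a x y /=; rewrite -linearP -[RHS]fE.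
  by rewrite linearP !sK.
pose F : {linear M -> N} :=
  HB.pack (l \o s) (GRing.isLinear.Build R M N *:%R (l \o s) flin).
by exists F => x /=; rewrite fE.
Qed.

End Lifting.

(** * Dimension over the base field *)

Lemma max_below (P : nat -> Prop) n :
  P 0%N -> ~ P n -> exists m, P m /\ ~ P m.+1.
Proof.
move=> P0 Pn; apply: contrapT => noP; apply: Pn.
elim: n => [//|n IHn]; apply: contrapT => PS; apply: noP; exists n; by [].
Qed.

Section FiniteDimension.
Variables (k : fieldType) (A : pzRingType) (iota : {rmorphism k -> A}).
Implicit Types (L M N : lmodType A^c).

Local Notation "c *k x" := ((iota c : A^c) *: x) (at level 40).

Lemma kscale0 M (x : M) : 0 *k x = 0.
Proof. by rewrite rmorph0; exact: scale0r. Qed.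

Lemma kscaleD M (c d : k) (x : M) : (c + d) *k x = c *k x + d *k x.
Proof. by rewrite -scalerDl; congr (_ *: _); exact: (rmorphD iota). Qed.

Lemma kscaleA M (c d : k) (x : M) : c *k (d *k x) = (d * c) *k x.
Proof. by rewrite scalerA rmorphM. Qed.

Lemma kscale_sum M (I : finType) (c : I -> k) (x : M) :
  (\sum_i c i) *k x = \sum_i c i *k x.
Proof.
by apply: (big_morph (fun c => c *k x)) => [c1 c2|]; rewrite (kscaleD, kscale0).
Qed.

Lemma kscaleK M (c : k) (x : M) : c != 0 -> c^-1 *k (c *k x) = x.
Proof.
by move=> c0; rewrite kscaleA mulfV // rmorph1; exact: scale1r.
Qed.

Definition kindep M n (v : 'I_n -> M) : Prop :=
  forall c : 'I_n -> k, \sum_i c i *k v i = 0 -> forall i, c i = 0.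

Definition kspan M n (v : 'I_n -> M) (x : M) : Prop :=
  exists c : 'I_n -> k, x = \sum_i c i *k v i.

(** Bounding independent families avoids choosing bases, and the bound passes to submodules at
    once. *)
Definition kdim_le M n : Prop := forall v : 'I_n.+1 -> M, ~ kindep v.

Definition fcons (T : Type) n (x : T) (v : 'I_n -> T) : 'I_n.+1 -> T :=
  fun i => if unlift ord0 i is Some j then v j else x.

Lemma fcons0 (T : Type) n (x : T) (v : 'I_n -> T) : fcons x v ord0 = x.
Proof. by rewrite /fcons unlift_none. Qed.

Lemma fconsS (T : Type) n (x : T) (v : 'I_n -> T) i :
  fcons x v (lift ord0 i) = v i.
Proof. by rewrite /fcons liftK. Qed.

Lemma kindep0 M (v : 'I_0 -> M) : kindep v.
Proof. by move=> c _ []. Qed.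

Lemma linear_ksum M N (f : {linear M -> N}) n (c : 'I_n -> k) (v : 'I_n -> M) :
  f (\sum_i c i *k v i) = \sum_i c i *k f (v i).
Proof. by rewrite linear_sum; apply: eq_bigr => i _; rewrite linearZ. Qed.

Lemma kindep_preim M N (f : {linear M -> N}) n (v : 'I_n -> M) :
  kindep (f \o v) -> kindep v.
Proof.
by move=> fv c sc; apply: fv; rewrite -linear_ksum sc raddf0.
Qed.

Lemma kindep_im M N (f : {linear M -> N}) n (v : 'I_n -> M) :
  injective f -> kindep v -> kindep (f \o v).
Proof.
by move=> fi iv c; rewrite -linear_ksum -(raddf0 f) => /fi; apply: iv.
Qed.

Lemma kindep_fcons M n (x : M) (v : 'I_n -> M) :
  kindep v -> ~ kspan v x -> kindep (fcons x v).
Proof.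
move=> iv nsp c; rewrite big_ord_recl fcons0.
under eq_bigr do rewrite fconsS.
move=> sc; have c0 : c ord0 = 0.
  apply: contrapT => /eqP c0; apply: nsp.
  (* Solve the relation for [x], dividing by its coefficient [c ord0]. *)
  exists (fun i => - (c (lift ord0 i)) * (c ord0)^-1).
  under eq_bigr do rewrite -kscaleA.
  rewrite -scaler_sumr -[x in LHS](kscaleK _ c0); congr (_ *: _).
  apply/eqP; rewrite -subr_eq0 -[eqbRHS]sc; apply/eqP; congr (_ + _).
  rewrite -sumrN; apply: eq_bigr => i _; rewrite raddfN; apply/eqP.
  by rewrite eqr_oppLR -scaleNr.
move: sc; rewrite c0 kscale0 add0r => /iv cS i.
by case: (unliftP ord0 i) => [j|] ->.
Qed.

Lemma kdim_le_inj M N (f : {linear N -> M}) n :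
  injective f -> kdim_le M n -> kdim_le N n.
Proof. by move=> fi Mn v iv; apply: (Mn (f \o v)); apply: kindep_im. Qed.

(** The coordinate matrix of [#|I|.+1] vectors has more rows than columns; a nonzero vector in its
    left kernel is a linear relation. *)
Lemma kdim_le_span M (I : finType) (g : I -> M) :
  (forall x, exists c : I -> k, x = \sum_i c i *k g i) -> kdim_le M #|I|.
Proof.
move=> sp v iv; have [c cE] := choice (fun i => sp (v i)).
pose C := \matrix_(i < #|I|.+1, j < #|I|) c i (enum_val j).
have: kermx C != 0.
  by rewrite kermx_eq0 /row_free neq_ltn ltnS rank_leq_col.
case/rowV0Pn => u /sub_kermxP uC /eqP; apply; apply/rowP => i; rewrite mxE.
apply: (iv (fun i => u 0 i)) => {i}.
under eq_bigr => i _ do rewrite cE scaler_sumr.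
rewrite exchange_big big1 // => j _.
under eq_bigr do rewrite kscaleA.
rewrite -kscale_sum; have /rowP/(_ (enum_rank j)) := uC.
rewrite !mxE => e; rewrite -[RHS](kscale0 (g j)) -[0 in RHS]e.
congr ((iota _ : A^c) *: _).
by apply: eq_bigr => i _; rewrite !mxE enum_rankK mulrC.
Qed.

(** An independent family of maximal length spans. *)
Lemma kspan_exists M n :
  kdim_le M n -> exists m (v : 'I_m -> M), forall x, kspan v x.
Proof.
move=> Mn; have [||m [[v iv] nm]] :=
  @max_below (fun m => exists v : 'I_m -> M, kindep v) n.+1.
- by exists (fun=> 0); apply: kindep0.
- by case=> v /Mn.
exists m, v => x; apply: contrapT => nsp; apply: nm.
by exists (fcons x v); apply: kindep_fcons.
Qed.

Lemma kdim_le_fg M n : kdim_le M n -> finitely_generated M.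
Proof.
case/kspan_exists => m [v sp]; exists m, v => x.
by have [c ->] := sp x; exists (fun i => iota (c i)).
Qed.

(** A nonzero vector of [N2] enlarges every independent family of [N1]. *)
Lemma kdim_le_summand N1 N2 n :
  kdim_le (N1 * N2)%type n.+1 -> ~ zero_module N2 -> kdim_le N1 n.
Proof.
move=> Nn nz v iv; apply: nz => x; apply: contrapT => x0.
pose w i : (N1 * N2)%type := (v i, 0).
apply: (Nn (fcons (0, x) w)); apply: kindep_fcons.
  exact: (@kindep_preim _ _ fst).
case=> c e; apply: x0; have := congr1 snd e; rewrite /= => ->.
rewrite (linear_ksum (snd : {linear (N1 * N2)%type -> N2})) big1 // => i _.
exact: scaler0.
Qed.

Lemma kdim_le0 M : kdim_le M 0 -> zero_module M.
Proof.
move=> M0 x; apply: contrapT => x0; have v : 'I_0 -> M by case.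
apply: (M0 (fcons x v)); apply: kindep_fcons; first exact: kindep0.
by case=> c; rewrite big_ord0.
Qed.

End FiniteDimension.

(** * Traces, rejects and pretorsion theories *)

Section LinearPairs.
Variables (R : pzRingType) (L M N : lmodType R).

Definition pair_fun (f : L -> M) (g : L -> N) x : (M * N)%type := (f x, g x).

Fact pair_fun_linear (f : {linear L -> M}) (g : {linear L -> N}) :
  linear (pair_fun f g).
Proof. by move=> a x y; rewrite /pair_fun !linearP. Qed.

HB.instance Definition _ (f : {linear L -> M}) (g : {linear L -> N}) :=
  GRing.isLinear.Build R L (M * N)%type *:%R (pair_fun f g)
    (pair_fun_linear f g).

End LinearPairs.

Section Classes.
Variable A : pzRingType.
Implicit Types (L M N X Y TX FX : fgmod A) (S T F Z : mod_class A).

Lemma isomorphic_bij (U V : lmodType A^c) (f : {linear U -> V}) :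
  injective f -> (forall z, exists x, f x = z) -> isomorphic U V.
Proof.
move=> fi /choice [g gK]; exists f; exists g => // x.
by apply: fi; rewrite gK.
Qed.

Lemma isomorphic_inverse (U V : lmodType A^c) :
  isomorphic U V ->
  exists (f : {linear U -> V}) (h : {linear V -> U}), cancel f h /\ cancel h f.
Proof.
case=> f [g fK gK]; have [||h hE] := @lift_injective _ _ _ _ f idfun.
- exact: can_inj fK.
- by move=> z; exists (g z); rewrite gK.
have hK : cancel h f by move=> z; exact/esym/hE.
by exists f, h; split=> // x; apply: (can_inj fK).
Qed.

Lemma isomorphic_sym (U V : lmodType A^c) : isomorphic U V -> isomorphic V U.
Proof. by case/isomorphic_inverse=> f [h [fK hK]]; exists h; exists f. Qed.

Lemma surj_fg M (N : lmodType A^c) (f : {linear M -> N}) :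
  (forall z, exists x, f x = z) -> finitely_generated N.
Proof.
move=> fs; have [n [g gE]] := fgmod_fg M; exists n, (f \o g) => z.
have [x <-] := fs z; have [a ->] := gE x; exists a.
by rewrite linear_sum; apply: eq_bigr => i _; rewrite linearZ.
Qed.

Lemma prod_fg M N : finitely_generated (M * N)%type.
Proof.
have [m [g gE]] := fgmod_fg M; have [n [h hE]] := fgmod_fg N.
exists (m + n)%N, (fun i => match split i with
  | inl i => (g i, 0) | inr i => (0, h i) end) => -[x y].
have [a ->] := gE x; have [b ->] := hE y.
exists (fun i => match split i with inl i => a i | inr i => b i end).
have splitl i : split (lshift n i) = inl i := unsplitK (inl i : 'I_m + 'I_n).
have splitr i : split (rshift m i) = inr i := unsplitK (inr i : 'I_m + 'I_n).
rewrite big_split_ord /=.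
under [X in _ = X + _]eq_bigr do rewrite splitl.
under [X in _ = _ + X]eq_bigr do rewrite splitr.
apply: injective_projections => /=; rewrite !linear_sum /=.
  by rewrite [X in _ + X]big1 ?addr0 // => i _; exact: scaler0.
by rewrite [X in X + _]big1 ?add0r // => i _; exact: scaler0.
Qed.

Definition fgprod M N := FgMod (prod_fg M N).

Lemma trivial_mor_precomp Z L M N (h : {linear L -> M}) (f : M -> N) :
  trivial_mor Z f -> trivial_mor Z (f \o h).
Proof.
case=> Z0 [ZZ0 [a [b fE]]]; exists Z0; split=> //; exists (a \o h), b => x.
exact: fE.
Qed.

Lemma trivial_mor_postcomp Z L M N (h : {linear M -> N}) (f : L -> M) :
  trivial_mor Z f -> trivial_mor Z (h \o f).
Proof.
case=> Z0 [ZZ0 [a [b fE]]]; exists Z0; split=> //; exists a, (h \o b) => x /=.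
by rewrite fE.
Qed.

(* For a pretorsion class [T] the images of all maps from [T] to [X] together
   form the largest submodule of [X] in [T], the trace; dually, the maps from
   [X] to a pretorsion-free class have a common kernel, the reject. *)
Definition is_trace T X TX (f : {linear TX -> X}) : Prop :=
  [/\ T TX, injective f &
      forall M (h : {linear M -> X}), T M -> forall m, exists t, f t = h m].

Definition is_reject F X FX (g : {linear X -> FX}) : Prop :=
  [/\ F FX, forall z, exists x, g x = z &
      forall N (h : {linear X -> N}), F N -> forall x, g x = 0 -> h x = 0].

Definition has_traces T : Prop :=
  forall X, exists TX (f : {linear TX -> X}), is_trace T f.

Definition has_rejects F : Prop :=
  forall X, exists FX (g : {linear X -> FX}), is_reject F g.

(** * Closure properties of classes with traces *)

Section Traces.
Variables (T : mod_class A) (Tiso : iso_closed T) (Ttr : has_traces T).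

Lemma trace_surj X TX (f : {linear TX -> X}) :
  is_trace T f -> (forall x, exists t, f t = x) -> T X.
Proof. by case=> TTX fi _ fs; apply: Tiso TTX; apply: isomorphic_bij fi fs. Qed.

(** The image of [p] lies in the trace of [N], which is therefore all of [N]. *)
Lemma has_traces_quotient M N (p : {linear M -> N}) :
  T M -> (forall z, exists x, p x = z) -> T N.
Proof.
move=> TM ps; have [TN [f trf]] := Ttr N; apply: (trace_surj trf) => z.
by have [x <-] := ps z; case: trf => _ _; apply.
Qed.

Lemma has_traces_prod M N : T M -> T N -> T (fgprod M N).
Proof.
move=> TM TN; have [TX [f trf]] := Ttr (fgprod M N).
apply: (trace_surj trf) => -[x y]; case: trf => _ _ trf.
have [t tE] := trf _ (pair_fun idfun \0) TM x.
have [u uE] := trf _ (pair_fun \0 idfun) TN y.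
exists (t + u); rewrite linearD tE uE.
by apply: injective_projections => /=; rewrite (addr0, add0r).
Qed.

Lemma has_traces_zero X : zero_module X -> T X.
Proof.
move=> X0; have [TX [f trf]] := Ttr X; apply: (trace_surj trf) => x.
by exists 0; rewrite raddf0 (X0 x).
Qed.

End Traces.

(** * The dual closure properties of classes with rejects *)

Section Rejects.
Variables (F : mod_class A) (Fiso : iso_closed F) (Frj : has_rejects F).

Lemma reject_inj X FX (g : {linear X -> FX}) :
  is_reject F g -> (forall x, g x = 0 -> x = 0) -> F X.
Proof.
case=> FFX gs _ g0; apply: Fiso FFX; apply: isomorphic_sym.
by apply: isomorphic_bij gs; apply: raddf_inj.
Qed.

Lemma has_rejects_sub M N (i : {linear M -> N}) : F N -> injective i -> F M.
Proof.
move=> FN ii; have [FM [g rjg]] := Frj M; apply: (reject_inj rjg) => x gx.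
by apply: ii; rewrite raddf0; case: rjg => _ _; apply.
Qed.

Lemma has_rejects_prod M N : F M -> F N -> F (fgprod M N).
Proof.
move=> FM FN; have [FX [g rjg]] := Frj (fgprod M N).
apply: (reject_inj rjg) => x gx; case: rjg => _ _ rjg.
apply: injective_projections; first exact: (rjg M fst).
exact: (rjg N snd).
Qed.

Lemma has_rejects_zero X : zero_module X -> F X.
Proof.
move=> X0; have [FX [g rjg]] := Frj X; apply: (reject_inj rjg) => x _.
exact: X0.
Qed.

End Rejects.

(** * From traces and rejects to a pretorsion theory *)

Section Criterion.
Variables (T F : mod_class A) (Tiso : iso_closed T) (Fiso : iso_closed F).
Hypotheses (Ttr : has_traces T) (Frj : has_rejects F).

(** The image of [f] is a quotient of [M] and a submodule of [N], hence lies in both classes. *)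
Lemma trivial_mor_image M N (f : {linear M -> N}) :
  T M -> F N -> trivial_mor (capclass T F) f.
Proof.
move=> TM FN; have [||I [i [ii iE]]] :=
  @submodule_exists _ N (fun y => exists x, f x = y).
- by exists 0; rewrite raddf0.
- by move=> a _ _ [x <-] [y <-]; exists (a *: x + y); rewrite linearP.
have [|p pE] := lift_injective (l := f) ii.
  by move=> x; apply/iE; exists x.
have ps z : exists x, p x = z.
  have /iE[x xE] : exists y, i y = i z by exists z.
  by exists x; apply: ii; rewrite -xE -[LHS]pE.
pose J := FgMod (surj_fg ps); exists J; split; last by exists p, i.
split; first exact: (@has_traces_quotient T Tiso Ttr M J p).
exact: (@has_rejects_sub F Fiso Frj J N i).
Qed.

(** The two conjuncts are (K) and (C): the first factors maps into [X] through the trace, the second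
    helps to factor maps out of [X] through [FX]. *)
Lemma pretorsion_theory_crit :
    (forall X TX FX (f : {linear TX -> X}) (g : {linear X -> FX}),
      is_trace T f -> is_reject F g ->
      (forall M (b : {linear M -> FX}) x m, T M -> g x = b m ->
         exists t, f t = x) /\
      (forall N (a : {linear TX -> N}) t, F N -> g (f t) = 0 -> a t = 0)) ->
  pretorsion_theory T F.
Proof.
move=> crit; split=> // [M N TM FN f|X]; first exact: trivial_mor_image.
have [TX [f trf]] := Ttr X; have [FX [g rjg]] := Frj X.
have [kerP cokerP] := crit _ _ _ _ _ trf rjg.
have [TTX fi _] := trf; have [FFX gs _] := rjg.
(* (K) for the zero map: the reject lies in the trace. *)
have ker0 x : g x = 0 -> exists t, f t = x.
  by move=> gx; apply: (kerP _ \0 x 0 TTX).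
exists TX, FX, f, g; split=> //; split; split.
- exact: (trivial_mor_image (g \o f)).
- move=> Y l [Z0 [[TZ0 _] [a [b gl]]]].
  have [|l' lE] := lift_injective (l := l) fi.
    by move=> y; apply: (kerP _ b _ (a y)) => //; exact: gl.
  by exists l' => // l'' l''E y; apply: fi; rewrite -[LHS]l''E -[RHS]lE.
- exact: (trivial_mor_image (g \o f)).
- move=> Y l [Z0 [[_ FZ0] [a [b lf]]]].
  have [|l' lE] := lift_surjective (l := l) gs.
    (* Here [l x = l (f t) = b (a t)], and [a t = 0] by (C). *)
    move=> x gx; have [t tx] := ker0 x gx.
    by rewrite -tx [LHS]lf /= (cokerP _ a) ?raddf0 // tx.
  exists l' => // l'' l''E z; have [x <-] := gs z.
  by rewrite -[LHS]l''E -[RHS]lE.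
Qed.

End Criterion.

(** * The case where every module is a sum of modules in [T] and [F] *)

Section Decomposable.
Variables (T F : mod_class A) (Tiso : iso_closed T) (Fiso : iso_closed F).
Hypotheses (Ttr : has_traces T) (Frj : has_rejects F).

(* A decomposition of [D] into a module in [T] and one in [F]; the remaining
   identities of a biproduct are not needed. *)
Definition splits_TF (D : lmodType A^c) : Prop :=
  exists (T1 F1 : fgmod A) (i : {linear T1 -> D}) (p : {linear D -> T1})
      (s : {linear F1 -> D}) (q : {linear D -> F1}),
    [/\ T T1, F F1 & forall x, x = i (p x) + s (q x)].

Lemma splits_TF_dsum (T0 F0 : fgmod A) n (V : 'I_n -> fgmod A) :
  T T0 -> F F0 -> (forall i, cupclass T F (V i)) -> splits_TF (dsum V).
Proof.
move=> TT0 FF0; elim: n V => [|n IHn] V TFV.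
  (* The empty sum needs some members of [T] and [F]; all maps are zero. *)
  exists T0, F0, \0, \0, \0, \0; split=> // x.
  by apply/rowP => -[].
have [|T1 [F1 [i [p [s [q [TT1 FF1 D]]]]]]] := IHn (fun i => V (lift ord0 i)).
  by move=> i; apply: TFV.
have [TV|FV] := TFV ord0.
  exists (fgprod (V ord0) T1), F1.
  exists (pair_fun fst (i \o snd)), (pair_fun fst (p \o snd)).
  exists (pair_fun \0 s), (q \o snd).
  split=> //; first exact: has_traces_prod.
  by move=> x; apply: injective_projections => /=; rewrite ?addr0 // -D.
exists T1, (fgprod (V ord0) F1).
exists (pair_fun \0 i), (p \o snd).
exists (pair_fun fst (s \o snd)), (pair_fun fst (q \o snd)).
split=> //; first exact: has_rejects_prod.
by move=> x; apply: injective_projections => /=; rewrite ?add0r // -D.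
Qed.

Lemma splits_TF_iso (D E : lmodType A^c) :
  isomorphic E D -> splits_TF D -> splits_TF E.
Proof.
move=> ED [T1 [F1 [i [p [s [q [TT1 FF1 DE]]]]]]].
have [f [h [fK hK]]] := isomorphic_inverse ED.
exists T1, F1, (h \o i), (p \o f), (h \o s), (q \o f); split=> // x /=.
by rewrite -linearD -DE fK.
Qed.

Lemma pretorsion_theory_add :
  eqclass (add_class (cupclass T F)) allclass -> pretorsion_theory T F.
Proof.
move=> addE; apply: pretorsion_theory_crit => // X TX FX f g trf rjg.
have [TTX fi trX] := trf; have [FFX gs rjX] := rjg.
have [_ /(_ I) [n [V [TFV XV]]]] := addE X.
have [T1 [F1 [i [p [s [q [TT1 FF1 XE]]]]]]] :=
  splits_TF_iso XV (splits_TF_dsum TTX FFX TFV).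
split=> [M b x m TM gx|N a t FN gft].
  (* (K): [q] kills the reject, so [q = q' \o g] and [x = i (p x) + s (q' (b m))], with both terms
     in the trace. *)
  have [q' q'E] := lift_surjective (l := q) gs (rjX _ q FF1).
  have [t tE] := trX _ i TT1 (p x).
  have [u uE] := trX _ (s \o (q' \o b)) TM m.
  exists (t + u); rewrite [RHS]XE linearD tE uE; congr (_ + s _).
  by rewrite q'E /= gx.
(* (C): since [q (f t) = 0], one has [t = i' (p (f t))], so [a t] is the value at [f t] of a map
   from [X] to [N], which kills the reject. *)
have [i' i'E] := lift_injective (l := i) fi (trX _ i TT1).
have qft : q (f t) = 0 by apply: (rjX _ q).
have tE : t = i' (p (f t)).
  by apply: fi; rewrite [LHS]XE qft raddf0 addr0; apply: i'E.
by rewrite tE; apply: (rjX _ (a \o (i' \o p))).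
Qed.

End Decomposable.

End Classes.

(** * Modules over a finite-dimensional algebra *)

Section FindimAlgebra.
Variables (k : fieldType) (A : pzRingType) (iota : {rmorphism k -> A}).
Hypothesis hA : findim_algebra iota.
Implicit Types (K L M N P Q X Y TX FX : fgmod A) (S T F Z : mod_class A).

(** Generators of [M] over [A], multiplied by those of [A] over [k], span [M] over [k]. *)
Lemma fg_kdim_le (M : lmodType A^c) :
  finitely_generated M -> exists n, kdim_le iota M n.
Proof.
case: hA => iotaC [n [e eE]] [m [g gE]]; exists #|{: 'I_m * 'I_n}|.
apply: (kdim_le_span (g := fun ij => (e ij.2 : A^c) *: g ij.1)) => x.
have [a ->] := gE x; have [c cE] := choice (fun i => eE (a i)).
exists (fun ij => c ij.1 ij.2).
rewrite -(pair_bigA _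
  (fun i j => (iota (c i j) : A^c) *: ((e j : A^c) *: g i))) /=.
apply: eq_bigr => i _; rewrite [a i]cE scaler_suml; apply: eq_bigr => j _.
(* The product of [A^c] is reversed; centrality of [iota] restores the order. *)
by rewrite scalerA iotaC.
Qed.

Lemma inj_fg M (N : lmodType A^c) (f : {linear N -> M}) :
  injective f -> finitely_generated N.
Proof.
move=> fi; have [n Mn] := fg_kdim_le (fgmod_fg M).
exact/kdim_le_fg/(kdim_le_inj fi Mn).
Qed.

Lemma ker_exists M (N : lmodType A^c) (f : {linear M -> N}) :
  exists K (j : {linear K -> M}),
    injective j /\ forall x, f x = 0 <-> exists y, j y = x.
Proof.
have [||K [j [ji jE]]] := @submodule_exists _ M (fun x => f x = 0).
- exact: raddf0.
- by move=> a x y fx fy; rewrite linearP fx fy scaler0 addr0.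
by exists (FgMod (inj_fg ji)), j.
Qed.

Lemma coker_exists (M : lmodType A^c) N (f : {linear M -> N}) :
  exists Q (q : {linear N -> Q}),
    (forall z, exists x, q x = z) /\ forall x, q x = 0 <-> exists y, f y = x.
Proof.
have [||Q [q [qs qE]]] := @quotient_exists _ N (fun y => exists x, f x = y).
- by exists 0; rewrite raddf0.
- by move=> a _ _ [x <-] [y <-]; exists (a *: x + y); rewrite linearP.
by exists (FgMod (surj_fg qs)), q.
Qed.

(** The inclusion [j] of the kernel of [f] and the zero map both lift [f \o j] through [f], so
    uniqueness identifies them. *)
Lemma Zkernel_inj Z X M N (f : {linear X -> M}) (g : {linear M -> N}) :
  Zkernel Z f g -> injective f.
Proof.
case=> gf kerP; apply: raddf_inj => x fx.
have [K [j [ji jE]]] := ker_exists f.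
have [|l' _ l'U] := kerP _ (f \o j); first exact: (trivial_mor_precomp j gf).
have [y <-] := (jE x).1 fx.
rewrite [LHS](l'U j) // -(l'U \0) // => z /=.
by rewrite raddf0; apply/jE; exists z.
Qed.

Lemma Zcokernel_surj Z L M N (f : {linear L -> M}) (g : {linear M -> N}) :
  Zcokernel Z g f -> forall z, exists x, g x = z.
Proof.
case=> gf cokerP; have [Q [q [qs qE]]] := coker_exists g.
have [|l' _ l'U] := cokerP _ (q \o g).
  exact: (trivial_mor_postcomp q gf).
move=> z; apply/qE; rewrite (l'U q) // -(l'U \0) // => x /=.
by apply/qE; exists x.
Qed.

(** * Traces, rejects and perpendicular classes of a pretorsion theory *)

Section PretorsionTheory.
Variables (T F : mod_class A).
Hypothesis pt : pretorsion_theory T F.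

Lemma pretorsion_theory_traces : has_traces T.
Proof.
case: pt => _ _ triv ex X; have [TX [FX [f [g [TTX FFX [kerP _]]]]]] := ex X.
exists TX, f; split=> //; first exact: Zkernel_inj kerP.
move=> M h TM m; case: kerP => _ /(_ _ h) [|h' hE _].
  exact: (triv _ _ _ _ (g \o h)).
by exists (h' m); rewrite hE.
Qed.

Lemma pretorsion_theory_rejects : has_rejects F.
Proof.
case: pt => _ _ triv ex X; have [TX [FX [f [g [TTX FFX [_ cokerP]]]]]] := ex X.
exists FX, g; split=> //; first exact: Zcokernel_surj cokerP.
move=> M h FM x gx; case: cokerP => _ /(_ _ h) [|h' hE _].
  exact: (triv _ _ _ _ (h \o f)).
by rewrite hE /= gx raddf0.
Qed.

Lemma pretorsion_theory_right_perp : subclass (right_perp T) F.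
Proof.
have Ttr := pretorsion_theory_traces; have Frj := pretorsion_theory_rejects.
case: pt => Tiso Fiso triv ex X Xperp.
have [TX [FX [f [g [TTX FFX [kerP cokerP]]]]]] := ex X.
have TX0 : zero_module TX.
  by move=> t; apply: (Zkernel_inj kerP); rewrite (Xperp _ TTX f t) raddf0.
(* [f] factors through [TX], which is zero and so lies in both classes; hence the identity of [X]
   factors through [g]. *)
have [_ /(_ X idfun) [|g' gE _]] := cokerP.
  exists TX; split; first by split=> //; exact: has_rejects_zero.
  by exists idfun, f.
apply: (Fiso FX) => //; apply: isomorphic_sym.
apply: (@isomorphic_bij _ _ _ g); last exact: Zcokernel_surj cokerP.
by move=> x y gxy; rewrite -[x]/(idfun x) gE /= gxy -[LHS]gE.
Qed.

Lemma pretorsion_theory_left_perp : subclass (left_perp F) T.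
Proof.
have Ttr := pretorsion_theory_traces; have Frj := pretorsion_theory_rejects.
case: pt => Tiso Fiso triv ex X Xperp.
have [TX [FX [f [g [TTX FFX [kerP cokerP]]]]]] := ex X.
have FX0 : zero_module FX.
  by move=> z; have [x <-] := Zcokernel_surj cokerP z; apply: Xperp.
have [_ /(_ X idfun) [|f' fE _]] := kerP.
  exists FX; split; first by split=> //; exact: has_traces_zero.
  by exists g, idfun.
apply: (Tiso TX) => //.
apply: (@isomorphic_bij _ _ _ f); first exact: Zkernel_inj kerP.
by move=> x; exists (f' x); exact/esym/fE.
Qed.

End PretorsionTheory.

Lemma pretorsion_class_traces T :
  pretorsion_class T -> iso_closed T /\ has_traces T.
Proof.
by case=> F pt; split; [case: pt|exact: pretorsion_theory_traces pt].
Qed.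

Lemma pretorsionfree_class_rejects F :
  pretorsionfree_class F -> iso_closed F /\ has_rejects F.
Proof.
by case=> T pt; split; [case: pt|exact: pretorsion_theory_rejects pt].
Qed.

(** * Torsion and torsion-free classes *)

Section ExtensionClosed.

(* The pullback of [q] along [b] is an extension of [M] by [K]. *)
Lemma extension_closed_pullback T K X Q M (j : {linear K -> X})
    (q : {linear X -> Q}) (b : {linear M -> Q}) x m :
    iso_closed T -> has_traces T -> extension_closed T ->
    injective j -> (forall x, q x = 0 <-> exists y, j y = x) ->
    (forall z, exists x, q x = z) ->
    T K -> T M -> q x = b m ->
  exists P (p : {linear P -> X}) y, T P /\ p y = x.
Proof.
move=> Tiso Ttr Text ji jE qs TK TM qx.
(* The pullback is the kernel of the difference of the two maps to [Q]. *)
pose d : {linear fgprod X M -> Q} := (q \o fst) \- (b \o snd).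
have [P [i [ii iE]]] := ker_exists d.
have [u uE] : exists u, i u = (x, m) by apply/iE; rewrite /= qx subrr.
exists P, (fst \o i), u; split; last by rewrite /= uE.
have di z : q (i z).1 = b (i z).2.
  by apply/eqP; rewrite -subr_eq0; apply/eqP/(iE (i z)); exists z.
have [|f fE] := @lift_injective _ _ _ _ i (pair_fun j \0) ii.
  by move=> y; apply/iE; rewrite /= raddf0 subr0; apply/jE; exists y.
have ifE y : i (f y) = (j y, 0) by exact/esym/fE.
apply: (Text K P M f (snd \o i)) => //.
- move=> y z fyz; apply: ji.
  by have := congr1 fst (ifE y); rewrite fyz ifE.
- move=> z /=; split=> [z0|[y <-]]; last by rewrite ifE.
  have [y yE] : exists y, j y = (i z).1 by apply/jE; rewrite di z0 raddf0.
  by exists y; apply: ii; rewrite ifE yE -z0 -surjective_pairing.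
- move=> y; have [x' x'E] := qs (b y).
  have [z zE] : exists z, i z = (x', y) by apply/iE; rewrite /= x'E subrr.
  by exists z; rewrite /= zE.
Qed.

(* The pushout of [h] along [j] is an extension of [Q] by [N]. *)
Lemma extension_closed_pushout F K X Q N (j : {linear K -> X})
    (q : {linear X -> Q}) (h : {linear K -> N}) :
    extension_closed F ->
    injective j -> (forall x, q x = 0 <-> exists y, j y = x) ->
    (forall z, exists x, q x = z) ->
    F Q -> F N ->
  exists P (p : {linear X -> P}), F P /\ forall y, p (j y) = 0 -> h y = 0.
Proof.
move=> Fext ji jE qs FQ FN.
(* The pushout is the cokernel of [d]; the sign identifies [(j y, 0)] with [(0, h y)]. *)
pose d : {linear K -> fgprod X N} := pair_fun j (\- h).
have [P [p [ps pE]]] := coker_exists d.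
exists P, (p \o pair_fun idfun \0); split; last first.
  move=> y /pE[z [/ji -> hy]]; by apply: oppr_inj; rewrite oppr0.
have [|f fE] := @lift_surjective _ _ _ _ p (q \o fst) ps.
  by move=> x /pE[y <-] /=; apply/jE; exists y.
apply: (Fext N P Q (p \o pair_fun \0 idfun) f) => //.
- apply: raddf_inj => y /pE[z [jz <-]].
  have -> : z = 0 by apply: ji; rewrite raddf0.
  by rewrite raddf0 oppr0.
- move=> z; have [[x y] <-] := ps z; rewrite -[f _]fE /=; split.
    case/jE=> w <-; exists (y + h w); apply/eqP; rewrite -subr_eq0 -linearB.
    apply/eqP/pE; exists (- w); apply: injective_projections => /=.
      by rewrite raddfN sub0r.
    by rewrite raddfN opprK addrAC subrr add0r.
  case=> w e; have /pE[v [jv _]] : p (x - 0, y - w) = 0.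
    by rewrite -[(_, _)]/((x, y) - (0, w)) linearB -e subrr.
  by apply/jE; exists v; rewrite jv subr0.
- by move=> z; have [x <-] := qs z; exists (p (x, 0)); rewrite -[f _]fE.
Qed.

Variables (T F : mod_class A).
Hypotheses (Ttors : torsion_class T) (Ftf : torsionfree_class F).

Lemma pretorsion_theory_of_left_perp :
  subclass (left_perp F) T -> pretorsion_theory T F.
Proof.
case: Ttors Ftf => /pretorsion_class_traces[Tiso Ttr] Text.
case=> /pretorsionfree_class_rejects[Fiso Frj] Fext perpT.
apply: pretorsion_theory_crit => // X TX FX f g [TTX fi trX] [FFX gs rjX].
have [K [j [ji jE]]] := ker_exists g.
(* The pushout [P] lies in [F], so the map from [X] to [P] kills the reject [K]; this forces
   [h = 0]. *)
have Kperp : left_perp F K.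
  move=> N FN h y.
  have [P [p [FP pj]]] := extension_closed_pushout h Fext ji jE gs FFX FN.
  by apply: pj; apply: rjX => //; apply/jE; exists y.
have TK := perpT K Kperp; split=> [M b x m TM gx|N a t FN gft].
  have [P [p [y [TP <-]]]] :=
    extension_closed_pullback Tiso Ttr Text ji jE gs TK TM gx.
  exact: trX.
(* (C): [K] is in [T], so [j] factors through the trace by [j'], and [a \o j'] vanishes because [K]
   has no nonzero map to [F]. *)
have [y yE] := (jE (f t)).1 gft.
have [j' j'E] := lift_injective (l := j) fi (trX _ j TK).
have -> : t = j' y by apply: fi; rewrite -yE; apply: j'E.
exact: (Kperp _ FN (a \o j')).
Qed.

(** The quotient of [X] by its trace receives no nonzero map from [T]: a pullback along such a map
    is in [T], so it lands in the trace. The quotient is thus in [F], and the projection from [X]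
    vanishes. *)
Lemma left_perp_of_right_perp :
  subclass (right_perp T) F -> subclass (left_perp F) T.
Proof.
case: Ttors => /pretorsion_class_traces[Tiso Ttr] Text perpF X Xperp.
have [TX [f trf]] := Ttr X; apply: (trace_surj Tiso trf) => x.
have [TTX fi trX] := trf.
have [Q [q [qs qE]]] := coker_exists f.
apply/qE; apply: (Xperp Q _ q x); apply: perpF => M TM b m.
have [y yE] := qs (b m); rewrite -yE; apply/qE.
have [P [p [z [TP <-]]]] :=
  extension_closed_pullback Tiso Ttr Text fi qE qs TTX TM yE.
exact: trX.
Qed.

End ExtensionClosed.

(* [S] is [T] or [F]: both are stable under direct summands. *)
Lemma indecomposable_generation S S' :
    (forall M N1 N2, isomorphic M (N1 * N2)%type -> S M -> S N1 /\ S N2) ->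
    iso_closed S' -> (forall M, zero_module M -> S' M) ->
    (forall M N, S' M -> S' N -> S' (fgprod M N)) ->
    subclass (capclass S indecomposable) S' ->
  subclass S S'.
Proof.
move=> Ssum S'iso S'0 S'prod S'ind M SM.
have [n] := fg_kdim_le (fgmod_fg M).
elim: n M SM => [|n IHn] M SM Mn; first exact/S'0/kdim_le0/Mn.
have [M0|M0] := lem (zero_module M); first exact: S'0.
have [Mi|Mi] := lem (indecomposable M); first exact: S'ind.
(* If [M] were not in [S'], both factors of a splitting could not be nonzero, since each would have
   smaller dimension and lie in [S']. *)
apply: contrapT => nS'; apply: Mi; split=> // N1 N2 MN.
apply: contrapT => /not_orP[N10 N20]; apply: nS'.
have [SN1 SN2] := Ssum _ _ _ MN SM.
have NM := isomorphic_sym MN; apply: (S'iso (fgprod N1 N2)) => //.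
have [h [f [hK _]]] := isomorphic_inverse NM.
have Nn := kdim_le_inj (can_inj hK) Mn.
(* The dimension drop is stated for the first factor; for [N2] the factors are swapped. *)
apply: S'prod; apply: IHn => //; first exact: kdim_le_summand Nn N20.
apply: (kdim_le_summand _ N10) => v iv.
apply: (Nn (pair_fun snd fst \o v)); apply: kindep_im iv.
by move=> [a1 b1] [a2 b2] [-> ->].
Qed.

Lemma pretorsion_class_Gen T :
  pretorsion_class T -> eqclass T (Gen (capclass T indecomposable)).
Proof.
move=> Tpt M; split=> [TM T' T'pt sub|]; last first.
  by apply=> // N [].
have [Tiso Ttr] := pretorsion_class_traces Tpt.
have [T'iso T'tr] := pretorsion_class_traces T'pt.
apply: (indecomposable_generation (S := T)) TM => //.
(* Direct summands are quotients, by the projections. *)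
- move=> N N1 N2 /isomorphic_inverse[f [h [fK hK]]] TN; split.
    apply: (has_traces_quotient Tiso Ttr (p := fst \o f) TN) => x.
    by exists (h (x, 0)); rewrite /= hK.
  apply: (has_traces_quotient Tiso Ttr (p := snd \o f) TN) => x.
  by exists (h (0, x)); rewrite /= hK.
- by move=> N; apply: has_traces_zero.
- by move=> N1 N2; apply: has_traces_prod.
Qed.

Lemma pretorsionfree_class_Cogen F :
  pretorsionfree_class F -> eqclass F (Cogen (capclass F indecomposable)).
Proof.
move=> Fpt M; split=> [FM F' F'pt sub|]; last first.
  by apply=> // N [].
have [Fiso Frj] := pretorsionfree_class_rejects Fpt.
have [F'iso F'rj] := pretorsionfree_class_rejects F'pt.
apply: (indecomposable_generation (S := F)) FM => //.
(* Direct summands are submodules, by the inclusions. *)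
- move=> N N1 N2 /isomorphic_inverse[f [h [fK hK]]] FN; split.
    apply: (has_rejects_sub Fiso Frj (i := h \o pair_fun idfun \0) FN).
    by move=> x y /(can_inj hK) [].
  apply: (has_rejects_sub Fiso Frj (i := h \o pair_fun \0 idfun) FN).
  by move=> x y /(can_inj hK) [].
- by move=> N; apply: has_rejects_zero.
- by move=> N1 N2; apply: has_rejects_prod.
Qed.

End FindimAlgebra.

Theorem propositionA1 (k : closedFieldType) (A : pzRingType)
    (iota : {rmorphism k -> A}) (hA : findim_algebra iota)
    (T F : mod_class A) (hT : iso_closed T) (hF : iso_closed F) :
  [/\ pretorsion_theory T F ->
        exists X Y : mod_class A,
          [/\ subclass X indecomposable, subclass Y indecomposable,
              eqclass T (Gen X) & eqclass F (Cogen Y)],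
      torsion_class T -> torsionfree_class F ->
        (pretorsion_theory T F <-> subclass (left_perp F) T) /\
        (pretorsion_theory T F <-> subclass (right_perp T) F),
      pretorsion_theory T F ->
        subclass (right_perp T) F /\ subclass (left_perp F) T &
      pretorsion_class T -> pretorsionfree_class F ->
        eqclass (add_class (cupclass T F)) allclass ->
        pretorsion_theory T F].
Proof.
split.
- move=> pt; exists (capclass T indecomposable), (capclass F indecomposable).
  split=> [M []|M []||] //; first by apply: (pretorsion_class_Gen hA); exists F.
  by apply: (pretorsionfree_class_Cogen hA); exists T.
- move=> Ttors Ftf; split; split=> [pt|sub].
  + exact: (pretorsion_theory_left_perp hA pt).
  + exact: (pretorsion_theory_of_left_perp hA Ttors Ftf).
  + exact: (pretorsion_theory_right_perp hA pt).
  + apply: (pretorsion_theory_of_left_perp hA Ttors Ftf).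
    exact: (left_perp_of_right_perp hA Ttors).
- move=> pt; split; first exact: (pretorsion_theory_right_perp hA pt).
  exact: (pretorsion_theory_left_perp hA pt).
- case/(pretorsion_class_traces hA) => _ Ttr.
  case/pretorsionfree_class_rejects => _ Frj.
  exact: pretorsion_theory_add.
Qed.
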